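(* Let $V$ be a finite vocabulary, $\mathcal{P}$ the set of probability distributions on $V$, $(\mathcal{K}, P_{\mathcal{K}})$ a key space with a key distribution, and $F:\mathcal{P}\times\mathcal{K}\to\mathcal{P}$ a distortion-free watermarking function. For $\lambda\in[0,1]$ define $F_\lambda(P,k)=\lambda F(P,k)+(1-\lambda)P$. Then for any $\lambda\in[0,1]$ and every next-token distribution $P\in\mathcal{P}$, $$\mathbb{E}_{k\sim P_{\mathcal{K}}}\big[H(F_\lambda(P,k))\big]\ \ge\ \mathbb{E}_{k\sim P_{\mathcal{K}}}\big[H(F(P,k))\big],$$ where $H$ denotes Shannon entropy.
   Context: $V$ is a finite nonempty set (the vocabulary), and $\mathcal{P}$ is the space of probability distributions over $V$. A language model's next-token distribution given a prefix is an element $P$ of $\mathcal{P}$. $\mathcal{K}$ is a key space equipped with a probability distribution $P_{\mathcal{K}}$. A watermarking function is a map $F:\mathcal{P}\times\mathcal{K}\to\mathcal{P}$; write $F(P,k)(x)$ for the probability that $F(P,k)$ assigns to $x\in V$. For each $P$ the map $k\mapsto F(P,k)$ is measurable. $F$ is distortion-free if for every $P\in\mathcal{P}$ and every $x\in V$, $\mathbb{E}_{k\sim P_{\mathcal{K}}}[F(P,k)(x)]=P(x)$. Shannon entropy is $H(P)=-\sum_{x\in V}P(x)\log P(x)$ (natural logarithm, $0\log 0=0$). *)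

(* Defs.v *)
From HB Require Import structures.
From mathcomp Require Import all_boot all_order all_algebra.
From mathcomp Require Import all_classical all_reals all_analysis.

Set Implicit Arguments.
Unset Strict Implicit.
Unset Printing Implicit Defensive.

Import Order.TTheory GRing.Theory Num.Theory.

Local Open Scope ring_scope.

Section Distributions.
Variables (R : realType) (V : finType).

Record simplex := Simplex {
  simplex_val :> {ffun V -> R};
  _ : [forall x, 0 <= simplex_val x] && (\sum_x simplex_val x == 1) }.

HB.instance Definition _ := [isSub for simplex_val].

Lemma simplex_ge0 (p : simplex) (x : V) : 0 <= p x.
Proof. by case: p => f /= /andP[/forallP/(_ x)]. Qed.

Lemma simplex_sum1 (p : simplex) : \sum_x p x = 1.
Proof. by case: p => f /= /andP[_ /eqP]. Qed.

(* [ln 0 = 0] in the library and [0 * _ = 0], so the convention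
   [0 log 0 = 0] holds. *)
Definition entropy (p : simplex) : R := - \sum_x p x * ln (p x).

Lemma simplex_mix_subproof (l : R) (p q : simplex) : 0 <= l <= 1 ->
  let f := [ffun x => l * p x + (1 - l) * q x] in
  [forall x, 0 <= f x] && (\sum_x f x == 1).
Proof.
move=> /andP[l0 l1] /=; apply/andP; split.
  by apply/forallP => x; rewrite ffunE addr_ge0// mulr_ge0 ?simplex_ge0 ?subr_ge0.
under eq_bigr do rewrite ffunE.
by rewrite big_split/= -!mulr_sumr !simplex_sum1 !mulr1 addrC subrK.
Qed.

Definition simplex_mix (l : R) (hl : 0 <= l <= 1) (p q : simplex) : simplex :=
  Simplex (simplex_mix_subproof p q hl).

End Distributions.

Section Watermarking.
Context {R : realType} {V : finType}.
Context {d : measure_display} {K : measurableType d}.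

(* Measurability of [k |-> F P k] into [simplex R V], seen as a subset of
   [R^V] with its product (Borel) sigma-algebra: a map into it is measurable
   iff all its coordinates are. *)
Definition watermarking (F : simplex R V -> K -> simplex R V) : Prop :=
  forall (P : simplex R V) (x : V), measurable_fun setT (fun k => F P k x).

Definition distortion_free (PK : probability K R)
    (F : simplex R V -> K -> simplex R V) : Prop :=
  forall (P : simplex R V) (x : V),
    ('E_PK[fun k => F P k x] = (P x)%:E)%E.

Definition interpolate (l : R) (hl : 0 <= l <= 1)
    (F : simplex R V -> K -> simplex R V) : simplex R V -> K -> simplex R V :=
  fun P k => simplex_mix hl (F P k) P.

End Watermarking.

(* Main.v *)
(** Shannon entropy is the sum over the vocabulary of [eta t = - t ln t]
    applied to the coordinates, and the inequality holds coordinatewise.  With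
    [X = F P k x], concavity gives
    [eta (l X + (1 - l) p) >= l eta X + (1 - l) eta p]; the watermark being
    distortion-free, [E X = p], and Jensen's inequality gives
    [eta p >= E (eta X)].  Both rest on the tangent bound
    [eta t <= - t ln c + c - t]. *)
Require Import Defs.
From mathcomp Require Import all_boot all_order all_algebra.
From mathcomp Require Import all_classical all_reals all_analysis.
From mathcomp Require Import measurable_realfun ring lra.

Set Implicit Arguments.
Unset Strict Implicit.
Unset Printing Implicit Defensive.

Import Order.TTheory GRing.Theory Num.Theory.
Local Open Scope ring_scope.

Section NegativeXlnx.
Variable R : realType.
Implicit Types t c p a b l : R.

Definition eta t : R := - (t * ln t).

Lemma eta0 : eta 0 = 0.
Proof. by rewrite /eta mul0r oppr0. Qed.

(** The right-hand side is the tangent line of [eta] at [c]. For [t > 0] the bound is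
    [ln u <= u - 1] at [u = c / t], multiplied by [t]; for [t = 0] it reduces to [0 <= c]. *)
Lemma eta_tangent t c : 0 <= t -> 0 < c -> eta t <= - (t * ln c) + c - t.
Proof.
rewrite le_eqVlt => /predU1P[<- c0|t0 c0]; first by rewrite eta0 mul0r; lra.
have ct0 : 0 < c / t by rewrite divr_gt0.
have : ln (1 + (c / t - 1)) <= c / t - 1 by apply: le_ln1Dx; lra.
rewrite [1 + _]addrC subrK ln_div// -(ler_pM2l t0) !mulrBr mulr1 /eta.
by rewrite [t * (c / t)]mulrC divfK ?gt_eqF//; lra.
Qed.

Lemma eta_ge0 t : 0 <= t <= 1 -> 0 <= eta t.
Proof. by move=> /andP[t0 t1]; rewrite oppr_ge0 mulr_ge0_le0// ln_le0. Qed.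

(** The tangent at 1 is [1 - t]. This crude bound serves only to make [eta] of a unit-valued
    variable integrable. *)
Lemma eta_le1 t : 0 <= t -> eta t <= 1.
Proof.
by move=> t0; have := eta_tangent t0 ltr01; rewrite ln1 mulr0 oppr0; lra.
Qed.

Lemma eta_concave l a b : 0 <= l <= 1 -> 0 <= a -> 0 <= b ->
  l * eta a + (1 - l) * eta b <= eta (l * a + (1 - l) * b).
Proof.
move=> /andP[l0 l1] a0 b0; have l1' : 0 <= 1 - l by rewrite subr_ge0.
set c := l * a + _.
have : 0 <= c by rewrite addr_ge0// mulr_ge0.
rewrite le_eqVlt => /predU1P[c0|c0].
  (* There is no tangent at 0, but [l * a] and [(1 - l) * b] both vanish here, so both sides are
     0. *)
  have /eqP : c = 0 by [].
  rewrite paddr_eq0 ?mulr_ge0// => /andP[/eqP la0 /eqP lb0].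
  by rewrite -c0 eta0 /eta !mulrN !mulrA la0 lb0 !mul0r; lra.
(* Both values are bounded by the same tangent, taken at the mixture [c]; the weighted sum of the
   bounds is that tangent evaluated at [c], which is [eta c]. *)
apply: (@le_trans _ _ (l * (- (a * ln c) + c - a)
    + (1 - l) * (- (b * ln c) + c - b))).
  by apply: lerD; apply: ler_wpM2l => //; exact: eta_tangent.
by rewrite le_eqVlt /eta /c; apply/orP; left; apply/eqP; ring.
Qed.

Lemma measurable_eta : measurable_fun setT eta.
Proof.
by apply: measurable_funN; apply: measurable_funM => //; exact: measurable_ln.
Qed.

End NegativeXlnx.

Section Expectation.
Context {R : realType} {d : measure_display} {K : measurableType d}.
Variable PK : probability K R.
Implicit Types X Y : K -> R.

Lemma bounded_Lfun1 X (M : R) : measurable_fun setT X ->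
  (forall k, `|X k| <= M) -> X \in Lfun PK 1.
Proof.
move=> mX XM; apply/Lfun1_integrable.
apply: measurable_bounded_integrable => //.
  by rewrite ltey_eq fin_num_measure.
exists M; split; first exact: num_real.
by move=> x Mx y _; apply: le_trans (XM y) (ltW Mx).
Qed.

Lemma unit_Lfun1 X : measurable_fun setT X -> (forall k, 0 <= X k <= 1) ->
  X \in Lfun PK 1.
Proof.
move=> mX X01; apply: (@bounded_Lfun1 _ 1) => // k.
by have /andP[X0 X1] := X01 k; rewrite ger0_norm.
Qed.

Lemma expectation_ler X Y : X \in Lfun PK 1 -> Y \in Lfun PK 1 ->
  (forall k, X k <= Y k) -> ('E_PK[X] <= 'E_PK[Y])%E.
Proof.
move=> /Lfun1_integrable iX /Lfun1_integrable iY XY.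
by rewrite unlock; apply: le_integral => // k _; rewrite lee_fin.
Qed.

Lemma expectation_affine X (a b : R) : X \in Lfun PK 1 ->
  ('E_PK[fun k => (a * X k + b)%R] = a%:E * 'E_PK[X] + b%:E)%E.
Proof.
move=> iX.
have -> : (fun k => a * X k + b) = (a \o* X) \+ cst b.
  by apply/funext => k /=; rewrite mulrC.
by rewrite expectationD ?expectationZl ?expectation_cst ?Lfun_cst ?Lfun_scale.
Qed.

Lemma Lfun1_affine X (a b : R) : X \in Lfun PK 1 ->
  (fun k => a * X k + b) \in Lfun PK 1.
Proof.
move=> iX.
have -> : (fun k => a * X k + b) = (a \o* X) \+ cst b.
  by apply/funext => k /=; rewrite mulrC.
by rewrite rpredD ?Lfun_cst ?Lfun_scale.
Qed.

Section UnitValued.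
Variable X : K -> R.
Hypotheses (mX : measurable_fun setT X) (X01 : forall k, 0 <= X k <= 1).

Lemma eta_Lfun1 : (fun k => eta (X k)) \in Lfun PK 1.
Proof.
apply: unit_Lfun1 => [|k].
  exact: measurableT_comp (@measurable_eta R) mX.
by rewrite eta_ge0// eta_le1//; case/andP: (X01 k).
Qed.

Lemma eta_jensen (p : R) : ('E_PK[X] = p%:E)%E ->
  ('E_PK[fun k => eta (X k)] <= (eta p)%:E)%E.
Proof.
move=> Xp.
have iX := unit_Lfun1 mX X01.
have p0 : 0 <= p.
  by rewrite -lee_fin -Xp expectation_ge0// => k; case/andP: (X01 k).
(* The tangent at [c] is affine in [X k], so its expectation depends on [X] only through the mean
   [p]. *)
have tangent c : 0 < c ->
    ('E_PK[fun k => eta (X k)] <= (- (p * ln c) + c - p)%:E)%E.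
  move=> c0; apply: (@le_trans _ _ 'E_PK[fun k => ((- ln c - 1) * X k + c)%R]%E).
    apply: expectation_ler => [||k]; [exact: eta_Lfun1|exact: Lfun1_affine|].
    have /andP[Xk0 _] := X01 k.
    by apply: le_trans (eta_tangent Xk0 c0) _; lra.
  by rewrite expectation_affine// Xp -EFinM -EFinD lee_fin; lra.
move: p0; rewrite le_eqVlt => /predU1P[p0|p0].
  (* No tangent at 0, but the tangents at [c] give the bound as [c -> 0+]. *)
  rewrite -p0 eta0; apply/lee_addgt0Pr => e e0.
  by have := tangent e e0; rewrite -p0 mul0r oppr0 add0r addr0 add0e.
(* The tangent at the mean itself takes the value [eta p] there. *)
by apply: le_trans (tangent p p0) _; rewrite lee_fin /eta; lra.
Qed.

Lemma expectation_eta_mix (l p : R) : 0 <= l <= 1 -> 0 <= p <= 1 ->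
  ('E_PK[X] = p%:E)%E ->
  ('E_PK[fun k => eta (X k)] <= 'E_PK[fun k => eta (l * X k + (1 - l) * p)%R])%E.
Proof.
move=> l01 p01 Xp; have [/andP[l0 l1] /andP[p0 p1]] := (l01, p01).
(* The expectation is finite, so the comparison below can be made in [R]. *)
have /expectation_fin_num/fineK Ea := eta_Lfun1.
have := eta_jensen Xp; rewrite -Ea lee_fin => Jp.
apply: (@le_trans _ _
    'E_PK[fun k => (l * eta (X k) + (1 - l) * eta p)%R]%E).
  rewrite expectation_affine; last exact: eta_Lfun1.
  rewrite -Ea -EFinM -EFinD lee_fin.
  (* This product is exactly the gap between the two sides; Jensen makes its second factor
     nonnegative. *)
  have : 0 <= (1 - l) * (eta p - fine 'E_PK[fun k => eta (X k)]%E).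
    by rewrite mulr_ge0// subr_ge0.
  by lra.
apply: expectation_ler => [||k].
- by apply: Lfun1_affine; exact: eta_Lfun1.
- apply: unit_Lfun1 => [|k].
    apply: (measurableT_comp (@measurable_eta R)).
    by apply: measurable_funD => //; exact: measurable_funM.
  have /andP[X0 X1] := X01 k.
  have Y01 : 0 <= l * X k + (1 - l) * p <= 1 by apply/andP; split; nra.
  by rewrite eta_ge0// eta_le1//; case/andP: Y01.
- by apply: eta_concave => //; case/andP: (X01 k).
Qed.

End UnitValued.
End Expectation.

Lemma simplex_unit (R : realType) (V : finType) (p : simplex R V) (x : V) :
  0 <= p x <= 1.
Proof.
rewrite simplex_ge0 -(simplex_sum1 p) (bigD1 x)//= lerDl sumr_ge0// => y _.
exact: simplex_ge0.
Qed.

(** Every coordinate lies in the unit interval, where [eta] is bounded; each term is therefore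
    integrable and the finite sum commutes with the integral. *)
Lemma expectation_entropy (R : realType) (V : finType) (d : measure_display)
    (K : measurableType d) (PK : probability K R) (G : K -> simplex R V) :
  (forall x, measurable_fun setT (fun k => G k x)) ->
  ('E_PK[fun k => entropy (G k)] = \sum_x 'E_PK[fun k => eta (G k x)])%E.
Proof.
move=> mG; rewrite unlock.
under eq_integral do rewrite /entropy -sumrN -sumEFin.
rewrite integral_sum// => x; apply/Lfun1_integrable.
by apply: eta_Lfun1 => // k; exact: simplex_unit.
Qed.

Theorem theorem4p4 (R : realType) (V : finType) (V_gt0 : (0 < #|V|)%N)
    (d : measure_display) (K : measurableType d) (PK : probability K R)
    (F : simplex R V -> K -> simplex R V)
    (F_watermarking : watermarking F)
    (F_distortion_free : distortion_free PK F)
    (lambda : R) (hlambda : 0 <= lambda <= 1) (P : simplex R V) :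
  ('E_PK[fun k => entropy (interpolate hlambda F P k)]
     >= 'E_PK[fun k => entropy (F P k)])%E.
Proof.
have mix k x : interpolate hlambda F P k x
    = lambda * F P k x + (1 - lambda) * P x by rewrite ffunE.
rewrite !expectation_entropy; last 2 first.
- move=> x; under eq_fun do rewrite mix.
  by apply: measurable_funD => //; exact: measurable_funM.
- exact: F_watermarking.
(* For each token [x], distortion-freeness says that [F P k x] has mean [P x], the very point it is
   mixed with. *)
apply: lee_sum => x _; under [X in (_ <= 'E_PK[X])%E]eq_fun do rewrite mix.
apply: expectation_eta_mix => //.
- by move=> k; exact: simplex_unit.
- exact: simplex_unit.
Qed.
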